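(* Every chair-free graph is $(2,2)$-linearly divisible. Consequently, if $G$ is a chair-free graph with clique number $\omega$, then $\chi(G)\leq 2\binom{\omega+1}{2}$.
   Context: All graphs are finite and simple; $\chi$ denotes chromatic number and $\omega$ denotes clique number. A chair is the graph obtained from $K_{1,3}$ by subdividing one edge once; a graph is chair-free if it has no induced subgraph isomorphic to a chair. Two vertex-disjoint subgraphs are complete to one another if every vertex of one is adjacent to every vertex of the other. For a nonnegative integer $r$, $[r]=\{1,\dots,r\}$, with $[0]=\emptyset$. Let $k,\ell$ be positive integers and let $G'$ be a nonempty graph with $\omega(G')=\omega$. A partition $V(G')=V(G_1)\sqcup V(G_2)$, where $G_1$ and $G_2$ are (possibly empty) induced subgraphs of $G'$, is a $(k,\ell)$-linear division of $G'$ if there exist an integer $r\ge 0$ and $\alpha\in\{0,\dots,\min\{\ell,\omega\}\}$ such that: (1) $V(G_1)=V(D_1)\sqcup\cdots\sqcup V(D_r)$, where $D_1,\dots,D_r$ are nonempty induced subgraphs of $G'$ that are pairwise complete to one another, and $\omega(G_1)\le\omega-\alpha$. Moreover, if $r=1$, then $\alpha\ge 1$; if $r\ge 2$, then $\omega(D_i)\ge 2$ for every $i\in[r]$; while if $r=0$, then $G_1$ is empty and $\alpha=\min\{\ell,\omega\}$. (2) If $r\in\{0,1\}$, then $\chi(G_2)\le k\alpha\left(\omega-\frac{\alpha-1}{2}\right)$; if $r\ge 2$, then $\chi(G_2)\le k\left((\alpha+2r-2)\left(\omega-\frac{\alpha+2r}{2}\right)+\frac{3\alpha}{2}\right)$.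 A graph $G$ is $(k,\ell)$-linearly divisible if every (nonempty) connected induced subgraph of $G$ admits a $(k,\ell)$-linear division. *)

(* Defs.v *)
From HB Require Import structures.
From mathcomp Require Import all_boot all_order all_algebra.

Set Implicit Arguments.
Unset Strict Implicit.
Unset Printing Implicit Defensive.

Import GRing.Theory Num.Theory.

Record sgraph := SGraph {
  vertex :> finType;
  adj : rel vertex;
  adj_sym : symmetric adj;
  adj_irrefl : irreflexive adj
}.

Section Induced.
Variables (G : sgraph) (A : {set G}).

Definition induced_vertex : finType := {x : G | x \in A}.

Definition induced_adj : rel induced_vertex :=
  fun x y => adj (val x) (val y).

Lemma induced_adj_sym : symmetric induced_adj.
Proof. by move=> x y; apply: adj_sym. Qed.

Lemma induced_adj_irrefl : irreflexive induced_adj.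
Proof. by move=> x; apply: adj_irrefl. Qed.

Definition induced : sgraph := SGraph induced_adj_sym induced_adj_irrefl.

End Induced.

Definition isomorphic (G H : sgraph) : Prop :=
  exists f : G -> H, bijective f /\ forall x y, adj (f x) (f y) = adj x y.

Definition connected (G : sgraph) : Prop :=
  forall x y : G, connect (@adj G) x y.

Definition clique (G : sgraph) (K : {set G}) : bool :=
  [forall x in K, forall y in K, (x != y) ==> adj x y].

Definition omega (G : sgraph) : nat := \max_(K : {set G} | clique K) #|K|.

Definition colorable (G : sgraph) (n : nat) : bool :=
  [exists c : {ffun G -> 'I_n}, forall x, forall y, adj x y ==> (c x != c y)].

Lemma ex_colorable (G : sgraph) : exists n, colorable G n.
Proof.
exists #|G|; apply/existsP; exists [ffun x => enum_rank x].
apply/forallP=> x; apply/forallP=> y; apply/implyP=> xy; rewrite !ffunE.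
by apply: contraTneq xy => /enum_rank_inj ->; rewrite adj_irrefl.
Qed.

Definition chi (G : sgraph) : nat := ex_minn (ex_colorable G).

(* The star with centre 0 and leaves 1, 2, 4, whose edge 04 is subdivided
   by the vertex 3. *)
Definition chair_edges : seq (nat * nat) :=
  [:: (0, 1); (0, 2); (0, 3); (3, 4)].

Definition chair_adj : rel 'I_5 := fun i j =>
  ((val i, val j) \in chair_edges) || ((val j, val i) \in chair_edges).

Lemma chair_adj_sym : symmetric chair_adj.
Proof. by move=> i j; rewrite /chair_adj orbC. Qed.

Lemma chair_adj_irrefl : irreflexive chair_adj.
Proof. by case; do 5?[case=> //]. Qed.

Definition chair : sgraph := SGraph chair_adj_sym chair_adj_irrefl.

Definition chair_free (G : sgraph) : Prop :=
  forall A : {set G}, ~ isomorphic (induced A) chair.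

Definition complete_to (G : sgraph) (A B : {set G}) : Prop :=
  forall x y, x \in A -> y \in B -> adj x y.

(* The subgraphs G_1, G_2 and D_1, ..., D_r are given by their vertex sets
   V1, V2 and D i.  The two bounds on the chromatic number are not integers
   term by term, hence are stated in rat. *)
Definition linear_division (k l : nat) (G : sgraph) (V1 V2 : {set G}) : Prop :=
  let w := omega G in
  [/\ V1 :|: V2 = [set: G], [disjoint V1 & V2] &
  exists (r alpha : nat) (D : 'I_r -> {set G}),
  [/\ alpha <= minn l w,
      [/\ V1 = \bigcup_i D i,
          forall i, D i != set0,
          forall i j, i != j -> [disjoint D i & D j],
          forall i j, i != j -> complete_to (D i) (D j) &
          omega (induced V1) <= w - alpha],
      [/\ r = 1 -> 1 <= alpha,
          2 <= r -> forall i, 2 <= omega (induced (D i)) &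
          r = 0 -> V1 = set0 /\ alpha = minn l w],
      r <= 1 ->
        ((chi (induced V2))%:R <=
         k%:R * alpha%:R * (w%:R - (alpha%:R - 1) / 2) :> rat)%R &
      2 <= r ->
        ((chi (induced V2))%:R <=
         k%:R * ((alpha%:R + 2 * r%:R - 2) * (w%:R - (alpha%:R + 2 * r%:R) / 2)
                 + 3 * alpha%:R / 2) :> rat)%R]].

Definition linearly_divisible (k l : nat) (G : sgraph) : Prop :=
  forall A : {set G}, A != set0 -> connected (induced A) ->
  exists V1 V2 : {set induced A}, linear_division k l V1 V2.

(* Main.v *)
Require Import Defs.
From mathcomp Require Import all_boot all_order all_algebra.
From mathcomp Require Import zify lra.

(** The heart of the matter is a transversal statement: every nonempty vertex
    set W of a chair-free graph contains a set X that meets all cliques of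
    maximum size of W and can be coloured with 2 omega(W) colours
    ([exists_transversal]).  Deleting X lowers the clique number, so (V - X, X)
    is a linear division with r <= 1; and removing such sets repeatedly uses at
    most 2 (omega + ... + 1) colours, which is the quadratic bound.

    The transversal is found by induction on W, according to its modules, that
    is, the sets H that no vertex of W outside H distinguishes.

    Suppose first that W has a proper module H containing two nonadjacent
    vertices a, b ([transversal_modules]).  If a vertex y of N(H) had both a
    neighbour c and a nonneighbour d, with c adjacent to d, in W - H - N(H),
    then y; a, b, c, d would be a chair.  Hence every component of W - N(H) is a
    module of W.  A maximum clique of W meets such a component in a maximum
    clique of the component or not at all, and it cannot lie inside N(H), as a
    vertex of H could be added.  So transversals of the components unite to a
    transversal of W, and no more colours are needed, because the components
    are anticomplete to one another.

    Otherwise all proper modules of W are cliques, and X = W - N(v) works for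
    any vertex v ([transversal_nbrs]): a clique inside N(v) extends by v.  What
    remains is to colour a component C of W - N[v] with 2 omega colours
    ([col_antineighbourhood]).  Take a smallest X in C that cannot be so
    coloured.  No vertex of X has a neighbourhood in X covered by two cliques,
    its degree being at least 2 omega.  Also, no module Z of X that is not a
    clique is covered by two cliques: such a Z is perfect, by Hall's theorem,
    so a colouring of X with Z replaced by a maximum clique of Z would extend
    to X.  Now choose a module Q of C, as small as possible, whose
    intersection with X is not a clique.  As Q is not a module of W, some
    neighbour y of v is mixed on Q.  Chairs with centre y show that a
    co-component of N(y) in Q is again a module of C ([nonadj_module]), so by
    minimality N(y) meets X and Q in a clique.  Chairs with a centre in C and
    path y, v show that N(z) - N(y) is a clique in C for z in N(y)
    ([far_nbrs_clique]).  These facts produce a vertex of X whose neighbourhood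
    is covered by two cliques, or exhibit the intersection of X and Q as a
    union of two cliques; both are impossible. *)

Set Implicit Arguments.
Unset Strict Implicit.
Unset Printing Implicit Defensive.

(** * Hall's marriage theorem *)

(** Rado's argument: shrink the sets F x as long as Hall's condition survives.
    Suppose that F x contains u1 != u2 and neither can be dropped, because of
    violating sets x |: S1 and x |: S2.  As the size of the union of the F z is
    submodular in the index set, Hall's condition then fails for S1 :&: S2 or
    for x |: (S1 :|: S2).  When no F x can be shrunk, all are singletons, and
    Hall's condition for pairs separates them.  The default u0 gives f a value
    outside A. *)
Lemma hall (T U : finType) (u0 : U) (A : {set T}) (F : T -> {set U}) :
  (forall S : {set T}, S \subset A -> #|S| <= #|\bigcup_(x in S) F x|) ->
  exists f : T -> U, {in A, forall x, f x \in F x} /\ {in A &, injective f}.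
Proof.
have [m] := ubnP (\sum_(x in A) #|F x|); elim: m F => // m IHm F le_m hallF.
have [/existsP[x /andP[xA Fx]]|small] := boolP [exists x in A, 1 < #|F x|].
  have [u1 [u2 [u1F u2F u12]]] : exists u1 u2, [/\ u1 \in F x, u2 \in F x & u1 != u2].
    by have /card_gt1P := Fx => -[u1 [u2 [? ? ?]]]; exists u1, u2.
  pose F' u z := if z == x then F x :\ u else F z.
  have subF u z : F' u z \subset F z.
    by rewrite /F'; case: eqP => [->|_] //; rewrite subsetDl.
  have step u : u \in F x ->
      (forall S : {set T}, S \subset A -> #|S| <= #|\bigcup_(z in S) F' u z|) ->
      exists f : T -> U, {in A, forall x, f x \in F x} /\ {in A &, injective f}.
    move=> uF hallF'; have [|f [fF f_inj]] := IHm (F' u) _ hallF'.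
      have: \sum_(z in A) #|F' u z| < \sum_(z in A) #|F z|; last by lia.
      rewrite (bigD1 x) //= [X in _ < X](bigD1 x) //= -addSn leq_add //.
        by rewrite /F' eqxx (cardsD1 u (F x)) uF.
      by apply: leq_sum => z _; apply/subset_leq_card/subF.
    by exists f; split=> // z zA; apply: (subsetP (subF u z)) (fF z zA).
  (* If u cannot be dropped, the violating set contains x; S is the rest of it. *)
  have tight u : u \in F x ->
      (exists f : T -> U, {in A, forall x, f x \in F x} /\ {in A &, injective f}) \/
      exists S : {set T}, [/\ S \subset A, x \notin S &
        #|(\bigcup_(z in S) F z) :|: (F x :\ u)| <= #|S|].
    move=> uF.
    have [/forallP all_ok|] :=
      boolP [forall S : {set T}, (S \subset A) ==> (#|S| <= #|\bigcup_(z in S) F' u z|)].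
      by left; apply: (step u uF) => S SA; have /implyP := all_ok S; apply.
    rewrite negb_forall => /existsP[S]; rewrite negb_imply -ltnNge => /andP[SA ltS].
    right; exists (S :\ x).
    have SxE : \bigcup_(z in S :\ x) F' u z = \bigcup_(z in S :\ x) F z.
      by apply: eq_bigr => z; rewrite /F' !inE => /andP[/negbTE->].
    have xS : x \in S.
      apply: contraLR ltS => xS; rewrite -leqNgt.
      have := hallF S SA; congr (_ <= #|pred_of_set _|).
      by apply: eq_bigr => z zS; rewrite /F'; case: eqP => // zx; rewrite -zx zS in xS.
    split; first by rewrite (subset_trans _ SA) ?subsetDl.
      by rewrite !inE eqxx.
    move: ltS; rewrite (bigD1 x) //= {1}/F' eqxx (cardsD1 x S) xS ltnS.
    have -> : \bigcup_(i in S | i != x) F' u i = \bigcup_(z in S :\ x) F z.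
      by rewrite -SxE; apply: eq_bigl => z; rewrite !inE andbC.
    by rewrite setUC.
  have [//|[S1 [S1A xS1 le1]]] := tight u1 u1F.
  have [//|[S2 [S2A xS2 le2]]] := tight u2 u2F.
  set P1 := _ :|: _ in le1; set P2 := _ :|: _ in le2.
  have leU : #|S1 :|: S2| < #|P1 :|: P2|.
    have xS : x \notin S1 :|: S2 by rewrite !inE negb_or xS1.
    have <- : #|x |: (S1 :|: S2)| = #|S1 :|: S2|.+1 by rewrite cardsU1 xS.
    have sA : x |: (S1 :|: S2) \subset A by rewrite !subUset sub1set xA S1A.
    apply: leq_trans (hallF _ sA) (subset_leq_card _).
    apply/bigcupsP => z; rewrite !inE => /or3P[/eqP->|zS|zS].
    - apply/subsetP => u uF; rewrite !inE uF !andbT.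
      by case: (eqVneq u u1) => [->|]; rewrite ?u12 /= ?orbT.
    - by rewrite -!setUA subsetU // (bigcup_sup z).
    - by rewrite subsetU // orbC subsetU // (bigcup_sup z).
  have leI : #|S1 :&: S2| <= #|P1 :&: P2|.
    have sA : S1 :&: S2 \subset A by rewrite subIset // S1A.
    apply: leq_trans (hallF _ sA) (subset_leq_card _).
    apply/bigcupsP => z; rewrite !inE => /andP[zS1 zS2].
    by rewrite subsetI !(subset_trans (bigcup_sup z _) (subsetUl _ _)).
  have := cardsUI S1 S2; have := cardsUI P1 P2; lia.
have F1 x : x \in A -> #|F x| = 1.
  move=> xA; apply/eqP; rewrite eqn_leq; apply/andP; split.
    by move: small; rewrite negb_exists => /forallP/(_ x); rewrite xA /= -leqNgt.
  by have := hallF [set x]; rewrite sub1set big_set1 cards1; apply.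
pose f x := odflt u0 [pick u in F x].
have fF x : x \in A -> f x \in F x.
  by move=> /F1 Fx; rewrite /f; case: pickP => //= F0; rewrite eq_card0 in Fx.
have FE x : x \in A -> F x = [set f x].
  move=> xA; have /eqP/cards1P[u Fu] := F1 x xA.
  by have := fF x xA; rewrite Fu inE => /eqP->.
exists f; split=> // x y xA yA fxy; apply/eqP/contraT => xy.
have := hallF [set x; y]; rewrite subUset !sub1set xA yA cards2 xy.
rewrite bigcup_setU !big_set1 !FE // fxy setUid cards1; exact.
Qed.

(** * Cliques and colourings of vertex sets *)

Section Graph.
Variable G : sgraph.
Implicit Types (x y z v : G) (A B C K L Q R S W X Y Z : {set G}).

Definition nbr x : {set G} := [set y | adj x y].

Lemma adjC x y : adj x y = adj y x. Proof. exact: adj_sym. Qed.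

Lemma adjxx x : adj x x = false. Proof. exact: adj_irrefl. Qed.

Lemma adj_neq x y : adj x y -> x != y.
Proof. by apply: contraTneq => ->; rewrite adjxx. Qed.

Lemma cliqueP K : reflect {in K &, forall x y, x != y -> adj x y} (clique K).
Proof.
apply: (iffP forall_inP) => [cl x y xK yK|cl x xK].
  by move/forall_inP: (cl x xK) => /(_ y yK)/implyP.
by apply/forall_inP => y yK; apply/implyP; apply: cl.
Qed.

Lemma cliquePn K :
  reflect (exists x y, [/\ x \in K, y \in K, x != y & ~~ adj x y]) (~~ clique K).
Proof.
apply: (iffP idP) => [|[x [y [xK yK xy nxy]]]]; last first.
  by apply: contra nxy => /cliqueP; apply.
rewrite negb_forall => /existsP[x]; rewrite negb_imply => /andP[xK].
rewrite negb_forall => /existsP[y]; rewrite negb_imply => /andP[yK].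
by rewrite negb_imply => /andP[xy nxy]; exists x, y.
Qed.

Lemma cliqueS K L : K \subset L -> clique L -> clique K.
Proof.
by move=> /subsetP KL /cliqueP cl; apply/cliqueP => x y /KL xL /KL; apply: cl.
Qed.

Lemma cliqueU K L : clique K -> clique L ->
  (forall x y, x \in K -> y \in L -> x != y -> adj x y) -> clique (K :|: L).
Proof.
move=> /cliqueP cK /cliqueP cL KL; apply/cliqueP => x y.
rewrite !inE => /orP[xK|xL] /orP[yK|yL] xy; [exact: cK|exact: KL| |exact: cL].
by rewrite adjC KL // eq_sym.
Qed.

Lemma clique0 : clique (set0 : {set G}).
Proof. by apply/cliqueP => x y; rewrite inE. Qed.

Lemma clique1 x : clique [set x].
Proof. by apply/cliqueP => y z; rewrite !inE => /eqP-> /eqP->; rewrite eqxx. Qed.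

Lemma clique_cons x K : clique K -> K \subset nbr x -> clique (x |: K).
Proof.
move=> cK /subsetP Kx; apply: cliqueU (clique1 x) cK _ => y z.
by rewrite inE => /eqP-> /Kx; rewrite inE.
Qed.

Definition omega_on W : nat :=
  \max_(K : {set G} | clique K && (K \subset W)) #|K|.

Lemma leq_omega_on W K : clique K -> K \subset W -> #|K| <= omega_on W.
Proof.
move=> cK KW.
by apply: (leq_bigmax_cond (P := fun K => clique K && (K \subset W))); rewrite cK.
Qed.

Lemma omega_on_max W :
  exists K, [/\ clique K, K \subset W & #|K| = omega_on W].
Proof.
have ex : 0 < #|[pred K : {set G} | clique K && (K \subset W)]|.
  by apply/card_gt0P; exists set0; rewrite inE clique0 sub0set.
have [K /andP[cK KW] eqK] := eq_bigmax_cond (fun K : {set G} => #|K|) ex.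
by exists K; rewrite /omega_on -eqK.
Qed.

Lemma omega_onS W W' : W \subset W' -> omega_on W <= omega_on W'.
Proof.
move=> sW; have [K [cK KW <-]] := omega_on_max W.
by apply: leq_omega_on cK _; apply: subset_trans sW.
Qed.

Lemma omega_on_gt0 W x : x \in W -> 0 < omega_on W.
Proof.
by move=> xW; rewrite -(cards1 x) leq_omega_on ?clique1 ?sub1set.
Qed.


Definition colorable_on X n := colorable (induced X) n.

Lemma colP X n :
  reflect (exists c : G -> nat, {in X, forall x, c x < n} /\
             {in X &, forall x y, adj x y -> c x != c y})
          (colorable_on X n).
Proof.
apply: (iffP existsP) => [[c /forallP cP]|[c [c_lt cP]]].
  exists (fun x => if insub x is Some u then c u : nat else 0).
  split=> [x xX|x y xX yX xy]; first by rewrite insubT.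
  rewrite !insubT; have /forallP/(_ (Sub y yX))/implyP := cP (Sub x xX).
  exact.
exists [ffun u : induced X => Ordinal (c_lt (val u) (valP u))].
apply/forallP => u; apply/forallP => w; apply/implyP => uw; rewrite !ffunE.
by have := cP _ _ (valP u) (valP w) uw.
Qed.

Lemma col_le X m n : m <= n -> colorable_on X m -> colorable_on X n.
Proof.
move=> mn /colP[c [cm cP]]; apply/colP; exists c; split=> // x xX.
by apply: leq_trans mn; apply: cm.
Qed.

Lemma colS X Y n : X \subset Y -> colorable_on Y n -> colorable_on X n.
Proof.
move=> /subsetP XY /colP[c [cm cP]]; apply/colP; exists c.
by split=> [x /XY|x y /XY xY /XY yY]; [apply: cm | apply: cP].
Qed.

Lemma col0 n : colorable_on set0 n.
Proof. by apply/colP; exists (fun=> 0); split=> x; rewrite inE. Qed.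

Lemma colU X Y m n :
  colorable_on X m -> colorable_on Y n -> colorable_on (X :|: Y) (m + n).
Proof.
move=> /colP[c [cm cP]] /colP[d [dn dP]]; apply/colP.
exists (fun x => if x \in X then c x else m + d x); split=> [x|x y].
  by rewrite inE; case: ifP => /= [/cm|_ /dn]; lia.
rewrite !inE; case: ifP => xX /= xY; case: ifP => yX /= yY xy.
- exact: cP.
- by have := cm x xX; apply/contraTneq => ->; lia.
- by have := cm y yX; apply/contraTneq => <-; lia.
- by rewrite eqn_add2l dP.
Qed.

Lemma col_add X z n : colorable_on (X :\ z) n -> #|nbr z :&: X| < n -> colorable_on X n.
Proof.
move=> /colP[c [cn cP]] deg.
pose used := [seq c y | y in nbr z :&: X].
have /hasP[i] : has [pred i | i \notin used] (iota 0 n).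
  apply: contraLR deg => /hasPn all_used; rewrite -leqNgt.
  rewrite -[X in X <= _](size_iota 0) cardE -(size_map c).
  apply: uniq_leq_size (iota_uniq 0 n) _ => i /all_used; rewrite negbK; exact.
rewrite mem_iota /= add0n => i_lt fresh; apply/colP.
have fresh_c y : y \in X -> adj z y -> i != c y.
  move=> yX zy; apply: contraNneq fresh => ->; apply: map_f.
  by rewrite mem_enum !inE zy.
exists (fun x => if x == z then i else c x); split=> [x xX|x y xX yX].
  by case: eqP => // /eqP xz; apply: cn; rewrite !inE xz.
case: (eqVneq x z) => [->|xz]; case: (eqVneq y z) => [->|yz] xy.
- by rewrite adjxx in xy.
- exact: fresh_c.
- by rewrite eq_sym fresh_c // adjC.
- by apply: cP; rewrite ?inE ?xz ?yz.
Qed.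

End Graph.

(** * Modules and unions of two cliques *)

Section Modules.
Variable G : sgraph.
Implicit Types (x y z v : G) (A B C D K L M Q R S W X Y Z : {set G}).

Definition module W Q : bool :=
  (Q \subset W) &&
  [forall w in W :\: Q, forall x in Q, forall y in Q, adj w x == adj w y].

Lemma moduleP W Q :
  reflect (Q \subset W /\ forall w x y, w \in W -> w \notin Q -> x \in Q ->
             y \in Q -> adj w x = adj w y)
          (module W Q).
Proof.
apply: (iffP andP) => -[QW mQ]; split=> //.
  move=> w x y wW wQ xQ yQ; move/forall_inP: mQ => /(_ w); rewrite inE wQ wW => /(_ isT).
  by move/forall_inP/(_ x xQ)/forall_inP/(_ y yQ)/eqP.
apply/forall_inP => w /setDP[wW wQ]; apply/forall_inP => x xQ.
by apply/forall_inP => y yQ; apply/eqP/mQ.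
Qed.

Lemma moduleI W Q X : X \subset W -> module W Q -> module X (X :&: Q).
Proof.
move=> /subsetP XW /moduleP[QW mQ]; apply/moduleP; split; first exact: subsetIl.
move=> w x y wX; rewrite !inE wX => wQ /andP[_ xQ] /andP[_ yQ].
exact: mQ (XW w wX) wQ xQ yQ.
Qed.

Lemma module_refl W : module W W.
Proof. by apply/moduleP; split=> // w x y ->. Qed.

Definition bicliq Z : Prop :=
  exists K L, [/\ clique K, clique L & Z = K :|: L].

(** In a union of two disjoint cliques, Z0 - K can be matched along
    nonadjacent pairs into the other side of a maximum clique K: if S violated
    Hall's condition, exchanging the few vertices of K in Z1 that miss some
    vertex of S against S would give a larger clique. *)
Lemma match_into_clique Z0 Z1 K : clique Z0 -> clique Z1 -> [disjoint Z0 & Z1] ->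
  clique K -> K \subset Z0 :|: Z1 -> #|K| = omega_on (Z0 :|: Z1) ->
  exists f : G -> G,
    {in Z0 :\: K, forall z, f z \in K :&: Z1 /\ ~~ adj z (f z)} /\
    {in Z0 :\: K &, injective f}.
Proof.
move=> c0 c1 dis cK KZ Kmax.
have [->|[u0 _]] := set_0Vmem (Z0 :\: K).
  by exists id; split=> z; rewrite inE.
have [S SZ|f [fF f_inj]] :=
    @hall _ _ u0 (Z0 :\: K) (fun z => (K :&: Z1) :\: nbr z).
  rewrite leqNgt; apply/negP => small.
  set N := \bigcup_(x in S) _ in small.
  have NK : N \subset K :&: Z1.
    by apply/bigcupsP => x _; rewrite subsetDl.
  have SZ0 : S \subset Z0 by apply: subset_trans SZ (subsetDl _ _).
  have cL : clique (S :|: (K :\: N)).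
    apply: cliqueU; [exact: cliqueS c0 | exact: cliqueS (subsetDl _ _) cK|].
    move=> x y xS /setDP[yK yN] xy.
    have /setUP[y0|y1] := subsetP KZ y yK.
      by move/cliqueP: c0; apply=> //; apply: (subsetP SZ0).
    apply: contraNT yN => nxy; apply/bigcupP; exists x => //.
    by rewrite !inE nxy yK.
  have LZ : S :|: (K :\: N) \subset Z0 :|: Z1.
    by rewrite subUset subsetU ?SZ0 //= (subset_trans (subsetDl _ _)).
  have := leq_omega_on cL LZ; rewrite -Kmax.
  rewrite cardsU disjoint_setI0 ?cards0 ?subn0; last first.
    rewrite disjoint_subset; apply/subsetP => x /(subsetP SZ).
    by rewrite !inE => /andP[/negbTE->]; rewrite andbF.
  have := cardsID N K; rewrite (setIidPr _) ?(subset_trans NK) ?subsetIl //.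
  lia.
exists f; split=> // z /fF; rewrite !inE => /andP[-> ->] //.
Qed.

(** A union of two cliques is perfect.  The colours are here the vertices of a
    maximum clique K; this form of colouring can be composed with a colouring
    of a larger graph around K.  Each vertex outside K takes its partner under
    one of the two matchings. *)
Lemma fold_bicliq Z : bicliq Z -> exists K (d : G -> G),
  [/\ clique K, K \subset Z, {in Z, forall x, d x \in K} &
      {in Z &, forall x y, adj x y -> d x != d y}].
Proof.
move=> [Z0 [Z1 [c0 c1 ZE]]].
have {}ZE : Z = Z0 :|: (Z1 :\: Z0).
  by rewrite ZE; apply/setP => x; rewrite !inE; case: (x \in Z0).
have {c1} : clique (Z1 :\: Z0) by apply: cliqueS c1; apply: subsetDl.
have : [disjoint Z0 & Z1 :\: Z0].
  by rewrite disjoint_sym disjoint_subset; apply/subsetP => x; rewrite !inE => /andP[].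
move: (Z1 :\: Z0) ZE => {}Z1 -> dis c1.
have [K [cK KZ Kmax]] := omega_on_max (Z0 :|: Z1).
have [f [fP f_inj]] := match_into_clique c0 c1 dis cK KZ Kmax.
have [|||g [gP g_inj]] := match_into_clique c1 c0 _ cK.
- by rewrite disjoint_sym.
- by rewrite setUC.
- by rewrite setUC.
exists K, (fun x => if x \in K then x else if x \in Z0 then f x else g x).
have Z1D x : x \in Z1 -> x \in Z0 = false.
  by move=> x1; rewrite (disjointFl dis).
have fK x : x \in Z0 -> x \notin K -> [/\ f x \in K, f x \in Z1 & ~~ adj x (f x)].
  by move=> x0 xK; have [|/setIP[]] := fP x; rewrite ?inE ?xK.
have gK x : x \in Z1 -> x \notin K -> [/\ g x \in K, g x \in Z0 & ~~ adj x (g x)].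
  by move=> x0 xK; have [|/setIP[]] := gP x; rewrite ?inE ?xK.
split=> // [x xZ|].
  case: ifPn => // xK; case/setUP: xZ => [x0|x1].
    by rewrite x0; have [] := fK x x0 xK.
  by rewrite Z1D //; have [] := gK x x1 xK.
have main x y : x \in Z0 :|: Z1 -> y \in Z0 :|: Z1 -> adj x y ->
    x \in K -> y \notin K -> x != (if y \in Z0 then f y else g y).
  move=> _ /setUP[y0|y1] xy xK yK; apply: contraTneq xy; rewrite adjC.
    by rewrite y0 => ->; have [] := fK y y0 yK.
  by rewrite Z1D // => ->; have [] := gK y y1 yK.
have cross x y : x \in Z0 -> y \in Z1 -> x \notin K -> y \notin K -> f x != g y.
  move=> x0 y1 xK yK; have [_ fx1 _] := fK x x0 xK; have [_ gy0 _] := gK y y1 yK.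
  by apply: contraTneq gy0 => <-; rewrite Z1D.
move=> x y xZ yZ xy; case: (boolP (x \in K)) => xK; case: (boolP (y \in K)) => yK.
- exact: adj_neq.
- exact: main.
- by rewrite eq_sym main // adjC.
case/setUP: xZ => [x0|x1]; case/setUP: yZ => [y0|y1].
- rewrite x0 y0; apply: contraTneq xy => /f_inj->; rewrite ?adjxx //.
    by rewrite inE xK.
  by rewrite inE yK.
- by rewrite x0 Z1D // cross.
- by rewrite y0 Z1D // eq_sym cross.
- rewrite !Z1D //; apply: contraTneq xy => /g_inj->; rewrite ?adjxx //.
    by rewrite inE xK.
  by rewrite inE yK.
Qed.

(** Vertices outside a module Z do not distinguish x in Z from its colour d x
    in K, so a colouring of what is left after folding Z onto K pulls back
    along d. *)
Lemma col_unfold X Z K n (d : G -> G) : module X Z -> clique K -> K \subset Z ->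
  {in Z, forall x, d x \in K} -> {in Z &, forall x y, adj x y -> d x != d y} ->
  colorable_on ((X :\: Z) :|: K) n -> colorable_on X n.
Proof.
move=> /moduleP[ZX mZ] /cliqueP cK /subsetP KZ dK dP /colP[c [cn cP]].
have inK x : x \in K -> x \in (X :\: Z) :|: K by rewrite !inE orbC => ->.
have inD x : x \in X -> x \notin Z -> x \in (X :\: Z) :|: K.
  by rewrite !inE => -> ->.
apply/colP; exists (fun x => if x \in Z then c (d x) else c x).
split=> [x xX|x y xX yX xy].
  by case: ifPn => xZ; apply: cn; [apply/inK/dK | apply: inD].
have dZ z : z \in Z -> d z \in Z by move=> zZ; apply: KZ; apply: dK.
case: (boolP (x \in Z)) => xZ; case: (boolP (y \in Z)) => yZ.
- apply: cP; [exact/inK/dK | exact/inK/dK |].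
  by apply: cK; [exact: dK | exact: dK | exact: dP].
- apply: cP; [exact/inK/dK | exact: inD |].
  by rewrite adjC (mZ y _ x) ?dZ // adjC.
- apply: cP; [exact: inD | exact/inK/dK |].
  by rewrite (mZ x _ y) ?dZ.
- by apply: cP; first exact: inD; first exact: inD.
Qed.

(** Folding Z onto a maximum clique of Z loses a vertex, as Z is not a clique;
    so X is not a minimal uncolourable set. *)
Lemma col_bicliq_module X Z n : module X Z -> ~~ clique Z -> bicliq Z ->
  (forall Y, Y \proper X -> colorable_on Y n) -> colorable_on X n.
Proof.
move=> mZ ncZ /fold_bicliq[K [d [cK KZ dK dP]]] colX.
apply: (col_unfold mZ cK KZ dK dP); apply: colX; rewrite properEneq.
have [ZX _] := moduleP _ _ mZ.
rewrite subUset subsetDl (subset_trans KZ ZX) !andbT.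
apply: contra ncZ => /eqP XE; apply: cliqueS cK; apply/subsetP => x xZ.
by have := subsetP ZX x xZ; rewrite -XE !inE xZ.
Qed.

(** Each of the two cliques extends by z, so the degree of z in X is at most
    2 (omega - 1). *)
Lemma col_bicliq_nbrs W X z : X \subset W -> z \in X -> bicliq (nbr z :&: X) ->
  (forall Y, Y \proper X -> colorable_on Y (2 * omega_on W)) ->
  colorable_on X (2 * omega_on W).
Proof.
move=> XW zX [K [L [cK cL NE]]] colX; apply: (@col_add _ _ z).
  by apply: colX; rewrite properD1.
have small A : clique A -> A \subset nbr z :&: X -> #|A| < omega_on W.
  move=> cA AN; have /subsetIP[Az AX] := AN.
  have /leq_omega_on : clique (z |: A) by apply: clique_cons.
  rewrite -add1n => /(_ W); rewrite subUset sub1set (subsetP XW) //.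
  rewrite (subset_trans AX XW) => /(_ isT); apply: leq_trans.
  rewrite cardsU1; case: (boolP (z \in A)) => // /(subsetP Az).
  by rewrite inE adjxx.
have := small K cK; have := small L cL; rewrite NE subsetUl subsetUr.
move=> /(_ isT) ? /(_ isT) ?; have [+ _] := leq_card_setU K L; lia.
Qed.

(** * Components and shortest paths *)
Definition edge_in W : rel G := [rel x y | [&& x \in W, y \in W & adj x y]].

Lemma edge_in_sym W : connect_sym (edge_in W).
Proof. by apply: sym_connect_sym => x y; rewrite /edge_in /= adjC andbCA. Qed.

Definition component W x : {set G} := [set z | connect (edge_in W) x z].

Definition conn C := {in C &, forall x y, connect (edge_in C) x y}.

Lemma component_id W x : x \in component W x.
Proof. by rewrite inE. Qed.

Lemma component_eq W x y : y \in component W x -> component W y = component W x.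
Proof.
rewrite inE => xy; apply/setP => z; rewrite !inE.
by rewrite (same_connect (@edge_in_sym W) xy).
Qed.

Lemma component_step W x y z :
  y \in component W x -> y \in W -> z \in W -> adj y z -> z \in component W x.
Proof.
rewrite !inE => xy yW zW yz; apply: connect_trans xy _; apply: connect1.
by rewrite /edge_in /= yW zW.
Qed.

Lemma component_closed W D x y :
  (forall a b, a \in D -> a \in W -> b \in W -> adj a b -> b \in D) ->
  x \in D -> y \in component W x -> y \in D.
Proof.
move=> clD xD; rewrite inE => /(@closed_connect _ _ (mem D)) <- // a b.
case/and3P=> aW bW ab; apply/idP/idP => [aD|bD]; first exact: clD ab.
by apply: clD bD _ _ _; rewrite // adjC.
Qed.

Lemma component_sub W x : x \in W -> component W x \subset W.
Proof.
by move=> xW; apply/subsetP => y; apply: component_closed.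
Qed.

Lemma conn_component W x : x \in W -> conn (component W x).
Proof.
move=> xW; suff xC y : y \in component W x -> connect (edge_in (component W x)) x y.
  by move=> y z /xC xy /xC; apply: connect_trans; rewrite edge_in_sym.
move=> yC; suff : y \in [set y in component W x | connect (edge_in (component W x)) x y].
  by rewrite inE => /andP[].
apply: component_closed yC; last by rewrite inE component_id connect0.
move=> a b; rewrite inE => /andP[aC xa] aW bW ab.
have bC := component_step aC aW bW ab; rewrite inE bC.
by apply: connect_trans xa (connect1 _); rewrite /edge_in /= aC bC.
Qed.

Lemma conn_cut C D x y : conn C -> x \in C -> y \in C -> x \in D -> y \notin D ->
  exists a b, [/\ a \in C, b \in C, a \in D, b \notin D & adj a b].
Proof.
move=> connC xC yC xD yD.
have [/existsP[a /existsP[b /and5P[? ? ? ? ?]]]|none] := boolP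
  [exists a, exists b, [&& a \in C, b \in C, a \in D, b \notin D & adj a b]].
  by exists a, b.
case/negP: yD; apply: (@component_closed C D x); rewrite ?inE ?connC //.
move=> a b aD aC bC ab; apply: contraNT none => bD.
by apply/existsP; exists a; apply/existsP; exists b; rewrite aC bC aD bD.
Qed.

(** The colouring is indexed by the component as a set, so that adjacent
    vertices consult the same one. *)
Lemma col_components M X n : X \subset M ->
  (forall x, x \in M -> colorable_on (X :&: component M x) n) -> colorable_on X n.
Proof.
move=> /subsetP XM colC.
have [D|c cP] := @fin_all_exists {set G} (fun=> G -> nat)
  (fun D c => colorable_on (X :&: D) n -> {in X :&: D, forall x, c x < n} /\
             {in X :&: D &, forall x y, adj x y -> c x != c y}).
  have [/colP[c cP]|_] := boolP (colorable_on (X :&: D) n); first by exists c.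
  by exists (fun=> 0).
apply/colP; exists (fun x => c (component M x) x); split=> [x xX|x y xX yX xy].
  by have [cn _] := cP _ (colC x (XM x xX)); apply: cn; rewrite inE xX component_id.
have yx : y \in component M x by apply: component_step xy; rewrite ?component_id ?XM.
rewrite (component_eq yx); have [_ cx] := cP _ (colC x (XM x xX)).
by apply: cx; rewrite // inE ?xX ?yX ?component_id.
Qed.

Lemma shortest_path (e : rel G) X v : (exists2 x, x \in X & connect e x v) ->
  exists z s, [/\ z \in X, path e z s, last z s = v &
    forall x t, x \in X -> path e x t -> last x t = v -> size s <= size t].
Proof.
pose P n := [exists z in X, exists t : n.-tuple G, path e z t && (last z t == v)].
have inP x t : x \in X -> path e x t -> last x t = v -> P (size t).
  move=> xX pt lt; apply/exists_inP; exists x => //.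
  by apply/existsP; exists (in_tuple t); rewrite /= pt lt eqxx.
move=> [x xX /connectP[t pt lt]].
have exP : exists n, P n by exists (size t); apply: (inP x).
case: (ex_minnP exP) => n /exists_inP[z zX /existsP[s /andP[ps /eqP ls]]] min_n.
exists z, s; split=> // y u yX pu lu; rewrite size_tuple.
by apply: min_n; apply: (inP y).
Qed.

End Modules.

(** * Local consequences of chair-freeness *)

(** The centre c has leaves a, b and the path p, q.  The other inequalities
    between the five vertices follow from the adjacencies. *)
Definition chairless (G : sgraph) : Prop := forall c a b p q : G,
  adj c a -> adj c b -> adj c p -> adj p q -> a != b ->
  ~~ adj a b -> ~~ adj a p -> ~~ adj b p ->
  ~~ adj c q -> ~~ adj a q -> ~~ adj b q -> False.

Section Chairless.
Variable G : sgraph.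
Hypothesis noC : chairless G.
Implicit Types (x y z v w : G) (A B C D K L M Q R S W X Y Z : {set G}).

(** Two nonadjacent such neighbours of c are the leaves of a chair with centre
    c and path y, v. *)
Lemma far_nbrs_clique v y c : adj v y -> adj y c -> ~~ adj v c ->
  clique [set b | [&& adj c b, ~~ adj y b & ~~ adj v b]].
Proof.
move=> vy yc vc; apply/contraT => /cliquePn[a [b []]].
rewrite !inE => /and3P[ca ya va] /and3P[cb yb vb] ab nab; exfalso.
by apply: (@noC c a b y v); rewrite // adjC.
Qed.

(** If c saw a but not b, then y would be the centre of a chair with leaves v, b
    and path a, c. *)
Lemma far_twins v y a b c : adj v y -> adj y a -> adj y b -> a != b ->
  ~~ adj a b -> v != a -> v != b -> ~~ adj v a -> ~~ adj v b -> ~~ adj v c ->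
  ~~ adj y c -> adj c a = adj c b.
Proof.
have half a' b' : adj v y -> adj y a' -> adj y b' -> ~~ adj a' b' -> v != b' ->
    ~~ adj v a' -> ~~ adj v b' -> ~~ adj v c -> ~~ adj y c -> adj c a' -> adj c b'.
  move=> vy ya yb nab vNb va vb vc yc ca; apply/contraT => ncb; exfalso.
  by apply: (@noC y v b' a' c) => //; rewrite adjC.
move=> vy ya yb ab nab vNa vNb va vb vc yc; apply/idP/idP; apply: half => //.
by rewrite adjC.
Qed.

Definition anticomplete v C : Prop := {in C, forall x, ~~ adj v x}.

(** P is the co-component of a in Q :&: nbr y.  Other vertices of Q :&: nbr y
    are complete to it, and a vertex of Q outside nbr y cannot change its
    adjacency along a nonedge of P, by [far_twins]. *)
Lemma nonadj_module v y C Q a b : anticomplete v C -> v \notin C -> adj v y ->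
  module C Q ->  a \in Q -> adj y a -> b \in Q -> adj y b -> a != b -> ~~ adj a b ->
  exists P, [/\ module C P, P \subset Q :&: nbr y, a \in P & b \in P].
Proof.
move=> vC vnC vy /moduleP[QC mQ] aQ ya bQ yb ab nab.
pose e := [rel x z | [&& x \in Q :&: nbr y, z \in Q :&: nbr y, x != z & ~~ adj x z]].
pose P := [set z | connect e a z].
have PQ : P \subset Q :&: nbr y.
  apply/subsetP => z; rewrite inE => /(@closed_connect _ _ (mem (Q :&: nbr y))) <-.
    by rewrite !inE aQ.
  by move=> x w /and4P[xA wA _ _]; rewrite xA wA.
have aP : a \in P by rewrite inE connect0.
exists P; split=> //; last by rewrite inE connect1 // /e /= !inE aQ bQ ya yb ab.
apply/moduleP; split.
  by apply: subset_trans PQ (subset_trans (subsetIl _ _) QC).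
suff uni w x : w \in C -> w \notin P -> x \in P -> adj w x = adj w a.
  by move=> w x z wC wP xP zP; rewrite !uni.
move=> wC wP xP; have /setIP[xQ yx] := subsetP PQ x xP.
have [wQ|wQ] := boolP (w \in Q); last exact: mQ.
have [yw|yw] := boolP (adj y w).
  have full z : z \in P -> adj w z.
    move=> zP; apply/contraT => wz; case/negP: (wP); move: (zP); rewrite !inE => az.
    apply: connect_trans az (connect1 _); have := subsetP PQ z zP.
    rewrite /e /= !inE wQ yw => -> /=; rewrite adjC wz andbT.
    by apply: contraTneq zP => ->; rewrite (negbTE wP).
  by rewrite !full.
have : x \in [set z | adj w z == adj w a].
  have ax : connect e a x by rewrite inE in xP.
  rewrite -(@closed_connect _ _ (mem [set z | adj w z == adj w a]) _ _ _ ax).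
    by rewrite inE.
  move=> s t /and4P[/setIP[sQ ys] /setIP[tQ yt] st nst]; rewrite !inE; congr (_ == _).
  move: ys yt; rewrite !inE => ys yt.
  have vN r : r \in Q -> v != r by move=> /(subsetP QC) rC; apply: contraNneq vnC => ->.
  by apply: (far_twins vy ys yt st nst); rewrite ?vC // ?vN // ?(subsetP QC).
by rewrite inE => /eqP.
Qed.

(** Follow a shortest path z, p, g, h, ... from X through C to y and v; it has
    at least three edges because y and v have no neighbours in X.  By minimality g and h
    see nothing of X.  A neighbour of z in X is either missed by p, and then
    such vertices form a clique because of the path p, g at z, or it is seen by
    p, and then because of the path g, h at p. *)
Lemma bicliq_far X C v y : X \subset C -> conn C -> anticomplete v C -> adj v y ->
  v \notin C -> y \notin C -> (exists2 a, a \in C & adj y a) ->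
  X != set0 -> anticomplete y X ->
  exists2 z, z \in X & bicliq (nbr z :&: X).
Proof.
move=> XC connC vC vy vnC ynC [a aC ya] /set0Pn[x0 x0X] yX.
set e := edge_in (v |: (y |: C)).
have [|z [s [zX ps ls min_s]]] := @shortest_path G e X v.
  exists x0 => //; have x0C := subsetP XC x0 x0X.
  have sub : subrel (connect (edge_in C)) (connect e).
    apply: connect_sub => s t /and3P[sC tC st]; apply: connect1.
    by rewrite /e /edge_in /= !inE sC tC !orbT.
  apply: connect_trans (sub _ _ (connC _ _ x0C aC)) _.
  apply: (@connect_trans _ _ y); apply: connect1; rewrite /e /edge_in /= !inE.
    by rewrite aC eqxx !orbT adjC.
  by rewrite !eqxx orbT adjC.
have zC := subsetP XC z zX.
(* A path with at most two edges would put v in C, or z in N(v) or N(y). *)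
case: s ps ls min_s => [|p [|g [|h s]]] /=.
- by move=> _ zv; rewrite -zv zC in vnC.
- rewrite andbT => /and3P[_ _ zp] pv; case/negP: (vC z zC).
  by rewrite -pv adjC.
- rewrite andbT => /andP[/and3P[_ pS zp] /and3P[_ _ pg]] gv.
  move: pS; rewrite gv in pg; rewrite !inE => /or3P[/eqP pv|/eqP py|pC].
  + by rewrite pv adjxx in pg.
  + by case/negP: (yX z zX); rewrite -py adjC.
  + by case/negP: (vC p pC); rewrite adjC.
move=> /and4P[/and3P[zS pS zp] /and3P[_ gS pg] /and3P[_ hS gh] ps] ls min_s.
have XS c : c \in X -> c \in v |: (y |: C).
  by move=> /(subsetP XC) cC; rewrite !inE cC !orbT.
have eS a' b' : a' \in v |: (y |: C) -> b' \in v |: (y |: C) -> adj a' b' -> e a' b'.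
  by move=> aS bS ab; rewrite /e /edge_in /= aS bS.
have egh : e g h by apply: eS.
have ezp : e z p by apply: eS.
have far_g c : c \in X -> ~~ adj g c.
  move=> cX; apply/negP => gc.
  have ecg : e c g by apply: eS; rewrite 1?adjC //; apply: XS.
  have pc : path e c [:: g, h & s] by apply/and3P.
  by have := min_s c _ cX pc ls; rewrite /= ltnn.
have far_h c : c \in X -> ~~ adj h c.
  move=> cX; apply/negP => hc.
  have ech : e c h by apply: eS; rewrite 1?adjC //; apply: XS.
  have pc : path e c [:: h & s] by apply/andP.
  by have := min_s c _ cX pc ls; rewrite /= ltnNge leqnSn.
have hp : ~~ adj h p.
  apply/negP => hp.
  have eph : e p h by apply: eS; rewrite // adjC.
  have pc : path e z [:: p, h & s] by apply/and3P.
  by have := min_s z _ zX pc ls; rewrite /= ltnn.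
have gp : adj g p by rewrite adjC.
have pz : adj p z by rewrite adjC.
have hg : adj h g by rewrite adjC.
exists z => //; exists (nbr z :&: X :\: nbr p), (nbr z :&: X :&: nbr p); split.
- apply: cliqueS (far_nbrs_clique gp pz (far_g z zX)).
  by apply/subsetP => c; rewrite !inE => /and3P[-> -> cX]; rewrite far_g.
- apply: cliqueS (far_nbrs_clique hg gp hp).
  by apply/subsetP => c; rewrite !inE => /andP[/andP[_ cX] ->]; rewrite far_g ?far_h.
- by rewrite setUC setID.
Qed.

(** * Colouring the nonneighbours of a vertex *)

(** C is meant to be a component of the nonneighbours of v; the last premise
    holds when all proper modules of the whole graph are cliques.  Induction on
    X makes X a minimal counterexample, to which [col_bicliq_nbrs] and
    [col_bicliq_module] apply. *)
Lemma col_antineighbourhood W C v : C \subset W -> conn C -> v \notin C ->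
  anticomplete v C ->
  (forall Q, module C Q -> ~~ clique Q -> exists y q q',
     [/\ adj v y, q \in Q, q' \in Q, adj y q & ~~ adj y q']) ->
  forall X, X \subset C -> colorable_on X (2 * omega_on W).
Proof.
move=> CW connC vnC vC sep X.
have [m] := ubnP #|X|; elim: m X => // m IHm X leXm XC.
have {IHm leXm} IH Y : Y \proper X -> colorable_on Y (2 * omega_on W).
  move=> YX; apply: IHm; first by have := proper_card YX; lia.
  by apply: subset_trans (proper_sub YX) XC.
apply/contraT => ncol; have XW := subset_trans XC CW.
have ncliq z : z \in X -> bicliq (nbr z :&: X) -> False.
  by move=> zX bz; case/negP: ncol; apply: (col_bicliq_nbrs XW zX bz).
have nmod Z : module X Z -> bicliq Z -> clique Z.
  by move=> mZ bZ; apply: contraNT ncol => ncZ; apply: (col_bicliq_module mZ).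
have ncX : ~~ clique X.
  apply/negP => cX; have [X0|[z zX]] := set_0Vmem X.
    by rewrite X0 col0 in ncol.
  apply: (ncliq z zX); exists (nbr z :&: X), set0; rewrite clique0 setU0.
  by split=> //; apply: cliqueS cX; apply: subsetIr.
pose cand Q := module C Q && ~~ clique (X :&: Q).
have candC : cand C by rewrite /cand module_refl (setIidPl XC).
case: (arg_minnP (fun Q => #|Q|) candC) => Q /andP[mQ ncQ] minQ.
have [QC uniQ] := moduleP _ _ mQ.
have [|y [q0 [q1 [vy q0Q q1Q yq0 yq1]]]] := sep Q mQ.
  by apply: contra ncQ; apply: cliqueS; apply: subsetIr.
(* Otherwise the co-component of a nonadjacent pair would be a smaller candidate;
   it misses q1. *)
have cA : clique (X :&: Q :&: nbr y).
  apply/contraT => /cliquePn[a [b []]]; rewrite !inE.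
  move=> /andP[/andP[aX aQ] ya] /andP[/andP[bX bQ] yb] ab nab.
  have [P [mP PA aP bP]] := nonadj_module vC vnC vy mQ aQ ya bQ yb ab nab.
  suff /minQ : cand P.
    rewrite leqNgt => /negP[]; apply: proper_card; apply/properP.
    split; first by apply: subset_trans PA (subsetIl _ _).
    by exists q1 => //; apply: contra yq1 => /(subsetP PA); rewrite !inE => /andP[].
  rewrite /cand mP; apply/cliquePn; exists a, b.
  by rewrite !inE aX aP bX bP.
have far_clique z : z \in C -> adj y z -> clique (nbr z :&: C :\: nbr y).
  move=> zC yz; apply: cliqueS (far_nbrs_clique vy yz (vC z zC)).
  by apply/subsetP => c; rewrite !inE => /and3P[-> -> cC]; rewrite vC.
have deg z : z \in X -> adj y z -> ~~ clique (nbr z :&: X :&: nbr y).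
  move=> zX yz; apply/negP => cz; apply: (ncliq z zX).
  exists (nbr z :&: X :&: nbr y), (nbr z :&: X :\: nbr y); rewrite setID.
  split=> //; apply: cliqueS (far_clique z (subsetP XC z zX) yz).
  by rewrite setSD // setIS.
have ynC : y \notin C by apply: contraL vy; apply: vC.
(* With Q = C, either a neighbour of y in X has small degree, or y is far from X. *)
have [QeC|QnC] := eqVneq Q C.
  have [A0|[z]] := set_0Vmem (X :&: nbr y).
    have [|||z zX bz] := bicliq_far XC connC vC vy vnC ynC; last by case: (ncliq z zX bz).
    - by exists q0; rewrite -?QeC.
    - by apply: contraNneq ncX => ->; rewrite clique0.
    - move=> z zX; apply/negP => yz; have : z \in X :&: nbr y by rewrite !inE zX.
      by rewrite A0 inE.
  rewrite !inE => /andP[zX yz]; case/negP: (deg z zX yz); apply: cliqueS cA.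
  by rewrite QeC (setIidPl XC) setSI // subsetIr.
(* As C is connected, some vertex b of C outside Q is complete to Q. *)
have [q2 q2C q2Q] : exists2 b, b \in C & b \notin Q.
  have : Q \proper C by rewrite properEneq QnC.
  by case/properP.
have [a [b [aC bC aQ bQ ab]]] := conn_cut connC (subsetP QC _ q0Q) q2C q0Q q2Q.
have bfull x : x \in Q -> adj b x.
  by move=> xQ; rewrite (uniQ b x a) // adjC.
have mZ : module X (X :&: Q) by apply: moduleI XC mQ.
have bcZ K L : X :&: Q = K :|: L -> clique K -> clique L -> False.
  by move=> ZE cK cL; case/negP: ncQ; apply: nmod => //; exists K, L.
have [cB|] := boolP (clique (X :&: Q :\: nbr y)).
  by case: (bcZ (X :&: Q :&: nbr y) (X :&: Q :\: nbr y)); rewrite ?setID.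
case/cliquePn=> p [p' []]; rewrite !inE.
move=> /and3P[yp pX pQ] /and3P[yp' p'X p'Q] pp' npp'.
(* A common neighbour z of y, p and p' in C contradicts [far_clique]. *)
have anti z : z \in C -> (forall x, x \in Q -> adj z x) -> ~~ adj y z.
  move=> zC zfull; apply/negP => yz.
  have /cliqueP/(_ p p') := far_clique z zC yz; rewrite !inE yp yp' !zfull //.
  by rewrite !(subsetP QC) // (negbTE npp') pp' => /(_ isT isT isT).
have yb := anti b bC bfull.
(* Nonadjacent s, t would be leaves of a chair with centre b and path q, y. *)
have cQN q : q \in Q -> adj y q -> clique (Q :\: nbr y :\: nbr q).
  move=> qQ yq; apply/contraT => /cliquePn[s [t []]]; rewrite !inE.
  move=> /and3P[qs ys sQ] /and3P[qt yt tQ] st nst; exfalso.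
  by apply: (@noC b s t q y) => //; rewrite 1?adjC // adjC bfull.
(* If y misses the part of X in Q, then N(q0) splits this part into two cliques;
   otherwise it contains a neighbour z of y, and by [anti] the neighbours of z
   in X :&: nbr y all lie in Q, so that they form a clique. *)
have [A0|[z]] := set_0Vmem (X :&: Q :&: nbr y).
  exfalso; have sub : X :&: Q \subset Q :\: nbr y.
    apply/subsetP => z zZ; have /setIP[_ zQ] := zZ; rewrite !inE zQ andbT.
    apply/negP => yz; have : z \in X :&: Q :&: nbr y by rewrite inE zZ inE.
    by rewrite A0 inE.
  apply: (bcZ (X :&: Q :&: nbr q0) (X :&: Q :\: nbr q0)); first by rewrite setID.
    apply: cliqueS (far_clique q0 (subsetP QC _ q0Q) yq0).
    apply/subsetP => z /setIP[zZ zq0]; have := subsetP sub z zZ.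
    by move: zq0; rewrite !inE => -> /andP[-> /(subsetP QC)->].
  by apply: cliqueS (cQN q0 q0Q yq0); rewrite setSD.
rewrite !inE => /andP[/andP[zX zQ] yz]; case/negP: (deg z zX yz).
apply: cliqueS cA; apply/subsetP => c; rewrite !inE => /andP[/andP[zc cX] yc].
rewrite cX yc andbT /=; apply: contraTT yc => cQ; have cC := subsetP XC c cX.
by apply: anti => // x xQ; rewrite (uniQ c x z) // adjC.
Qed.

End Chairless.

(** * Small-chromatic transversals of the maximum cliques *)

Section Transversal.
Variable G : sgraph.
Hypothesis noC : chairless G.
Implicit Types (x y z v w h : G) (A B C D H K L M Q R S W X Y Z : {set G}).

Definition transversal W X : bool :=
  [&& X \subset W, colorable_on X (2 * omega_on W) & omega_on (W :\: X) < omega_on W].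

Lemma omega_on_ltP W n :
  (forall K, clique K -> K \subset W -> #|K| < n) -> omega_on W < n.
Proof. by move=> ltn; have [K [cK KW <-]] := omega_on_max W; apply: ltn. Qed.

(** R is the neighbourhood of H in W.  No maximum clique lies in R, since a is
    complete to R; and the components of M are proper modules of W, because a
    vertex of R mixed on one of them is the centre of a chair with leaves a, b.
    The union of transversals of these components is therefore a transversal
    of W. *)
Lemma transversal_modules W H : module W H -> H != W -> ~~ clique H ->
  (forall D, D \proper W -> D != set0 -> exists X, transversal D X) ->
  exists X, transversal W X.
Proof.
move=> mH HnW /cliquePn[a [b [aH bH ab nab]]] IH.
have [HW uniH] := moduleP _ _ mH; have aW := subsetP HW a aH.
pose R := [set w in W :\: H | adj w a].
pose M := W :\: R.
have MH x y : x \in M -> x \notin H -> y \in H -> ~~ adj x y.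
  rewrite !inE => /andP[+ xW] xH yH; rewrite xH xW /=.
  by rewrite (uniH x a y).
have RH x y : x \in R -> y \in H -> adj x y.
  by rewrite !inE => /andP[/andP[xH xW] xa] yH; rewrite (uniH x y a).
have compH x : x \in H -> component M x \subset H.
  move=> xH; apply/subsetP => y; apply: component_closed xH => s t sH sM tM st.
  by apply: contraLR st => tH; rewrite adjC MH.
have compNH x : x \in M -> x \notin H -> component M x \subset M :\: H.
  move=> xM xH; apply/subsetP => y; apply: component_closed; last by rewrite inE xM xH.
  move=> s t /setDP[_ sH] sM tM st; rewrite inE tM andbT.
  by apply: contraTN st => tH; rewrite MH.
have mD x : x \in M -> module W (component M x).
  move=> xM; have DM := component_sub xM; apply/moduleP; split.
    by apply: subset_trans DM (subsetDl _ _).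
  suff uni w y z : w \in W -> w \notin component M x -> y \in component M x ->
      z \in component M x -> adj w y -> adj w z.
    by move=> w y z wW wD yD zD; apply/idP/idP; apply: uni.
  move=> wW wD yD zD wy; have yM := subsetP DM y yD; have zM := subsetP DM z zD.
  have [wM|wM] := boolP (w \in M).
    by case/negP: wD; apply: component_step yD yM wM _; rewrite adjC.
  have wR : w \in R by move: wM; rewrite inE wW andbT negbK.
  have [xH|xH] := boolP (x \in H); first by rewrite RH // (subsetP (compH x xH)).
  apply/contraT => wz.
  have [||c [d [cD dD wc wd cd]]] :=
      @conn_cut _ _ (nbr w) y z (conn_component xM) yD zD; rewrite ?inE //.
  rewrite !inE in wc wd.
  have /setDP[cM cH] := subsetP (compNH x xM xH) c cD.
  have /setDP[dM dH] := subsetP (compNH x xM xH) d dD.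
  by exfalso; apply: (@noC w a b c d) => //; first [exact: RH | rewrite adjC MH].
have properD x : x \in M -> component M x \proper W.
  move=> xM; rewrite properEneq; have [-> _] := moduleP _ _ (mD x xM); rewrite andbT.
  have [xH|xH] := boolP (x \in H).
    apply: contraNneq HnW => DW; rewrite eqEsubset HW -DW compH //.
  apply/eqP => DW; have : a \in component M x by rewrite DW.
  by move/(subsetP (compNH x xM xH)); rewrite inE aH.
have [D|t tP] := @fin_all_exists {set G} (fun=> {set G})
    (fun D X => D \proper W -> D != set0 -> transversal D X).
  have [DW|] := boolP (D \proper W); last by exists set0.
  have [->|D0] := eqVneq D set0; first by exists set0.
  by have [X XP] := IH D DW D0; exists X.
have {}tP x : x \in M -> transversal (component M x) (t (component M x)).
  move=> xM; apply: tP; first exact: properD.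
  by apply/set0Pn; exists x; apply: component_id.
pose X := [set x in M | x \in t (component M x)].
have XD x : x \in M -> X :&: component M x = t (component M x).
  move=> xM; have /and3P[/subsetP tD _ _] := tP x xM.
  apply/setP => y; apply/setIP/idP => [[]|yt].
    by rewrite inE => /andP[_ yt] yx; rewrite -(component_eq yx).
  have yD := tD y yt; split=> //.
  by rewrite inE (component_eq yD) yt (subsetP (component_sub xM)).
exists X; apply/and3P; split.
- by apply/subsetP => x; rewrite inE => /andP[/setDP[]].
- apply: (@col_components _ M); first by apply/subsetP => x; rewrite inE => /andP[].
  move=> x xM; rewrite XD //; have /and3P[_ colt _] := tP x xM.
  apply: col_le colt; rewrite leq_mul2l omega_onS //.
  exact: proper_sub (properD x xM).
apply: omega_on_ltP => K cK /subsetP KWX.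
have KW : K \subset W by apply/subsetP => x /KWX /setDP[].
have [KM|[k /setIP[kK kM]]] := set_0Vmem (K :&: M).
  have KR x : x \in K -> x \in R.
    move=> xK; apply/contraT => xR.
    have : x \in K :&: M by rewrite !in_setI in_setD xK xR (subsetP KW).
    by rewrite KM inE.
  have aK : a \notin K by apply/negP => /KR; rewrite !inE aH.
  have : clique (a |: K).
    by apply: clique_cons cK _; apply/subsetP => x /KR xR; rewrite inE adjC RH.
  move/leq_omega_on => /(_ W); rewrite cardsU1 aK add1n; apply.
  by rewrite subUset sub1set aW.
(* K meets the component D of k, but not in a maximum clique L of D: exchange. *)
set D := component M k; have [DW uniD] := moduleP _ _ (mD k kM).
have kD : k \in D by apply: component_id.
have [L [cL LD Lmax]] := omega_on_max D.
have KD : #|K :&: D| < #|L|.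
  have /and3P[_ _] := tP k kM; rewrite -/D -Lmax; apply: leq_ltn_trans.
  apply: leq_omega_on; first by apply: cliqueS cK; apply: subsetIl.
  apply/subsetP => x /setIP[xK xD]; rewrite inE xD andbT.
  have /setDP[_] := KWX x xK; apply: contra => xt; have : x \in X :&: D by rewrite XD.
  by case/setIP.
have LK : clique (L :|: (K :\: D)).
  apply: cliqueU => //; first by apply: cliqueS cK; apply: subsetDl.
  move=> x y /(subsetP LD) xD /setDP[yK yD] _.
  rewrite adjC (uniD y x k) // ?(subsetP KW) //; move/cliqueP: cK; apply=> //.
  by apply: contraNneq yD => ->.
have LW : L :|: (K :\: D) \subset W.
  by rewrite subUset (subset_trans LD DW) (subset_trans (subsetDl _ _) KW).
have := leq_omega_on LK LW; rewrite cardsU disjoint_setI0 ?cards0 ?subn0.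
  move=> le_LK; rewrite -(cardsID D K); apply: leq_trans le_LK.
  by rewrite -addSn leq_add2r.
rewrite disjoint_subset; apply/subsetP => x /(subsetP LD) xD.
by rewrite inE in_setD xD.
Qed.

(** A clique avoiding the transversal lies in N(v) and extends by v.  A module Q
    of a component C that no neighbour of v distinguishes is a module of W,
    hence a clique, as [col_antineighbourhood] requires. *)
Lemma transversal_nbrs W v : v \in W ->
  (forall H, module W H -> H != W -> clique H) ->
  transversal W (W :\: nbr v).
Proof.
move=> vW onlycl; apply/and3P; split; first exact: subsetDl; last first.
  apply: omega_on_ltP => K cK KN.
  have KWv : K \subset W :&: nbr v.
    by apply: subset_trans KN _; rewrite setDDr setDv set0U.
  have /subsetIP[KW Kv] := KWv.
  have /leq_omega_on : clique (v |: K) by apply: clique_cons.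
  move=> /(_ W); rewrite cardsU1 subUset sub1set vW KW => /(_ isT); apply: leq_trans.
  case: (boolP (v \in K)) => // /(subsetP Kv).
  by rewrite inE adjxx.
pose U := W :\: nbr v :\ v.
apply: (@col_add _ _ v); last first.
  rewrite setIDA [nbr v :&: W]setIC -setIDA setDv setI0 cards0.
  by have := omega_on_gt0 vW; lia.
apply: (@col_components _ U) => // x xU.
apply: colS (subsetIr _ _) _; set C := component U x.
have CU : C \subset U by apply: component_sub.
have UW : U \subset W by apply: subset_trans (subsetDl _ _) (subsetDl _ _).
have vC : anticomplete v C.
  by move=> y /(subsetP CU); rewrite !inE => /and3P[].
have vnC : v \notin C by apply/negP => /(subsetP CU); rewrite !inE eqxx.
apply: (@col_antineighbourhood _ noC W C v) => //; first exact: subset_trans UW.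
  exact: conn_component.
move=> Q mQ ncQ; have [QC uniQ] := moduleP _ _ mQ.
have [/existsP[y /existsP[q /existsP[q' /and5P[? ? ? ? ?]]]]|none] := boolP
    [exists y, exists q, exists q', [&& adj v y, q \in Q, q' \in Q, adj y q & ~~ adj y q']].
  by exists y, q, q'.
case/negP: ncQ; apply: onlycl.
  apply/moduleP; split; first exact: subset_trans QC (subset_trans CU UW).
  suff uni w y z : w \in W -> w \notin Q -> y \in Q -> z \in Q -> adj w y -> adj w z.
    by move=> w y z wW wQ yQ zQ; apply/idP/idP; apply: uni.
  move=> wW wQ yQ zQ wy; have yC := subsetP QC y yQ.
  have [vw|vw] := boolP (adj v w).
    apply: contraNT none => wz; apply/existsP; exists w; apply/existsP; exists y.
    by apply/existsP; exists z; rewrite vw yQ zQ wy.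
  have wC : w \in C.
    apply: (component_step yC (subsetP CU y yC)); last by rewrite adjC.
    by rewrite !inE vw wW !andbT; apply: contraTneq wy => ->; exact: (vC y yC).
  by rewrite -(uniQ w y z).
by apply: contraNneq vnC => QW; apply: (subsetP QC); rewrite QW.
Qed.

Theorem exists_transversal W : W != set0 -> exists X, transversal W X.
Proof.
have [m] := ubnP #|W|; elim: m W => // m IHm W leWm W0.
have [/existsP[H /and3P[mH HW ncH]]|none] := boolP
    [exists H, [&& module W H, H != W & ~~ clique H]].
  apply: (transversal_modules mH HW ncH) => D DW; apply: IHm.
  by have := proper_card DW; lia.
have /set0Pn[v vW] := W0; exists (W :\: nbr v); apply: transversal_nbrs => // H mH HW.
by apply: contraNT none => ncH; apply/existsP; exists H; rewrite mH HW.
Qed.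

(** Peeling off transversals costs 2 omega + 2 (omega - 1) + ... + 2 colours. *)
Lemma col_quadratic W : colorable_on W (2 * 'C(omega_on W + 1, 2)).
Proof.
have [m] := ubnP (omega_on W); elim: m W => // m IHm W leWm.
have [->|W0] := eqVneq W set0; first exact: col0.
have [X /and3P[XW colX ltX]] := exists_transversal W0.
have := colU colX (IHm (W :\: X) (leq_trans ltX leWm)).
rewrite -{1}(setIidPr XW) setID; apply: col_le.
have bin_mono i j : i <= j -> 'C(i, 2) <= 'C(j, 2).
  by move=> ij; rewrite !bin2; apply: half_leq; nia.
have := @bin_mono (omega_on (W :\: X) + 1) (omega_on W) _.
by rewrite [omega_on W + 1]addn1 binS bin1 addn1 => /(_ ltX); lia.
Qed.

End Transversal.

(** * From vertex sets to linear divisions *)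

Section Bridge.
Variable G : sgraph.
Implicit Types (A K W X : {set G}).

Lemma omega_induced W : omega (induced W) <= omega_on W.
Proof.
apply/bigmax_leqP => K /cliqueP cK.
rewrite -(card_imset _ val_inj); apply: leq_omega_on.
  apply/cliqueP => _ _ /imsetP[x xK ->] /imsetP[y yK ->] xy.
  by apply: (cK x y xK yK); apply: contraNneq xy => ->.
by apply/subsetP => _ /imsetP[x _ ->]; apply: valP.
Qed.

Lemma omega_on_setT : omega_on [set: G] = omega G.
Proof. by apply: eq_bigl => K; rewrite subsetT andbT. Qed.

Lemma chi_induced X n : colorable_on X n -> chi (induced X) <= n.
Proof. by move=> colX; rewrite /chi; case: ex_minnP => m _; apply. Qed.

Lemma chi_setT n : colorable_on [set: G] n -> chi G <= n.
Proof.
move=> /colP[c [cn cP]]; rewrite /chi; case: ex_minnP => m _; apply.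
apply/existsP; exists [ffun x => Ordinal (cn x (in_setT x))].
apply/forallP => x; apply/forallP => y; apply/implyP => xy; rewrite !ffunE.
exact: cP.
Qed.

Lemma chair_free_chairless : chair_free G -> chairless G.
Proof.
move=> noCh c a b p q ca cb cp pq ab nab nap nbp ncq naq nbq.
pose s := [:: c; a; b; p; q].
have cq : c != q by apply: contraNneq naq => <-; rewrite adjC.
have ap : a != p by apply: contraNneq naq => ->.
have aq : a != q by apply: contraNneq nap => ->; rewrite adjC.
have bp : b != p by apply: contraNneq nbq => ->.
have bq : b != q by apply: contraNneq nbp => ->; rewrite adjC.
have s_uniq : uniq s.
  rewrite /s /= !inE !negb_or cq ab ap aq bp bq.
  by rewrite (adj_neq ca) (adj_neq cb) (adj_neq cp) (adj_neq pq).
have adj_s i j : i < 5 -> j < 5 -> adj (nth c s i) (nth c s j) =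
    ((i, j) \in chair_edges) || ((j, i) \in chair_edges).
  have sym (x y : G) (e : bool) : adj x y = e -> (adj x y = e) * (adj y x = e).
    by rewrite [adj y x]adjC.
  have facts := (sym _ _ _ ca, sym _ _ _ cb, sym _ _ _ cp, sym _ _ _ pq,
    sym _ _ _ (negbTE nab), sym _ _ _ (negbTE nap), sym _ _ _ (negbTE nbp),
    sym _ _ _ (negbTE ncq), sym _ _ _ (negbTE naq), sym _ _ _ (negbTE nbq)).
  by case: i => [|[|[|[|[|i]]]]] //; case: j => [|[|[|[|[|j]]]]] // _ _;
     rewrite /= ?adjxx ?facts.
apply: (noCh [set x in s]).
have in_s (u : induced [set x in s]) : val u \in s.
  by have := valP u; rewrite inE.
have idx (u : induced [set x in s]) : index (val u) s < 5.
  by rewrite -[5]/(size s) index_mem.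
pose f u : chair := Ordinal (idx u).
have f_inj : injective f.
  move=> u w /(congr1 val) uw; apply: val_inj.
  by rewrite -(nth_index c (in_s u)) -(nth_index c (in_s w)); congr nth.
exists f; split=> [|u w].
  apply: inj_card_bij => //; rewrite card_ord card_sig.
  by rewrite (eq_card (B := mem s)) ?(card_uniqP s_uniq) // => x; rewrite !inE.
rewrite [RHS]/= /induced_adj -(nth_index c (in_s u)) -(nth_index c (in_s w)).
by rewrite adj_s.
Qed.

End Bridge.

Lemma chairless_induced (G : sgraph) (A : {set G}) :
  chairless G -> chairless (induced A).
Proof.
move=> noC c a b p q ca cb cp pq ab.
exact: (noC (val c) (val a) (val b) (val p) (val q) ca cb cp pq ab).
Qed.

(** With alpha = 1 the allowance for the chromatic number of the second part is
    2 omega.  If the transversal is everything, the first part is empty, so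
    r = 0 and alpha = min(2, omega), whose allowance is at least as large. *)
Lemma transversal_division (G : sgraph) (X : {set G}) :
  transversal [set: G] X -> linear_division 2 2 (~: X) X.
Proof.
case/and3P => _; rewrite setTD omega_on_setT => /chi_induced chiX ltX.
have w_gt0 : 0 < omega G by apply: leq_ltn_trans ltX.
have chiQ : ((chi (induced X))%:R <= 2 * (omega G)%:R :> rat)%R.
  by rewrite -GRing.natrM Num.Theory.ler_nat.
have wQ : (1 <= (omega G)%:R :> rat)%R by rewrite Num.Theory.ler1n.
split; first by rewrite setUC setUCr.
  by rewrite -setI_eq0 setIC setICr.
have [X0|X0] := eqVneq (~: X) set0.
  exists 0, (minn 2 (omega G)), (fun=> set0); split=> //.
  - split=> //; try by case.
      by rewrite big_ord0.
    rewrite X0; apply: leq_trans (omega_induced _) _.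
    by rewrite /omega_on big1 // => K; rewrite subset0 => /andP[_ /eqP->]; rewrite cards0.
  - move=> _; case: (ltnP 1 (omega G)) => w1.
      have : (2 <= (omega G)%:R :> rat)%R by rewrite Num.Theory.ler_nat.
      rewrite (minn_idPl w1) => ?; lra.
    have wE : omega G = 1 by apply/eqP; rewrite eqn_leq w1.
    by rewrite wE in chiQ *.
exists 1, 1, (fun=> ~: X); split; last by move=> r_gt1; exfalso.
- by rewrite leq_min w_gt0.
- split=> //.
  + by rewrite big_ord_recl big_ord0 setU0.
  + by move=> i j; rewrite !ord1.
  + by move=> i j; rewrite !ord1.
  + by apply: leq_trans (omega_induced _) _; rewrite subn1 -ltnS prednK.
- by split.
- by move=> _; lra.
Qed.

Theorem theorem1p3 (G : sgraph) (hG : chair_free G) :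
  linearly_divisible 2 2 G /\ chi G <= 2 * 'C(omega G + 1, 2).
Proof.
have noC := chair_free_chairless hG; split; last first.
  by apply: chi_setT; rewrite -omega_on_setT; apply: col_quadratic.
move=> A /set0Pn[x xA] _.
have [|X tX] := @exists_transversal _ (chairless_induced noC) [set: induced A].
  by apply/set0Pn; exists (Sub x xA : induced A).
by exists (~: X), X; apply: transversal_division.
Qed.
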